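(* Let $n=2^k+r$ with integers $k\ge 0$ and $0\le r<2^k$, and let $s_1(n)$ be the Hamming weight of $n$. Then $$\tau\left(\frac{r+1}{2^k}\right)=\tau\left(\frac{r}{2^k}\right)+\frac{1}{2^k}\left(k-2\,s_1(n)+2\right).$$
   Context: The Hamming weight $s_1(n)$ is the number of $1$s in the binary expansion of $n$. $\tau$ denotes the Takagi function on $[0,1]$, a continuous function. On dyadic rationals it is given as follows: for integers $k\ge 0$ and $0\le N<2^{k+1}$ with binary digits $N=\sum_{i=0}^{k}N_i2^i$, $N_i\in\{0,1\}$, and $N_i=0$ for every negative integer $i$, $\tau\left(\frac{N}{2^{k+1}}\right)=\sum_{i=1}^\infty \frac{\ell_i(N)}{2^i}$, where for $i\ge 0$, $\ell_{i+1}(N)=\sum_{j=0}^{i-1}N_{k-j}$ if $N_{k-i}=0$, and $\ell_{i+1}(N)=i-\sum_{j=0}^{i-1}N_{k-j}$ if $N_{k-i}=1$. Also $\tau(1)=0$. (Equivalently, $\tau(x)=\sum_{m=0}^\infty 2^{-m}\,\mathrm{dist}(2^m x,\mathbb{Z})$ for $x\in[0,1]$.) *)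

(* Defs.v *)
From mathcomp Require Import all_boot all_order all_algebra.
From mathcomp Require Import all_classical all_reals all_analysis.
Set Implicit Arguments.
Unset Strict Implicit.
Unset Printing Implicit Defensive.
Import Order.TTheory GRing.Theory Num.Theory.
Import numFieldNormedType.Exports.
Local Open Scope ring_scope.

Definition bit (n i : nat) : bool := odd (n %/ 2 ^ i)%N.

(* As n < 2 ^ n, all the 1s in the binary expansion of n are at positions
   i < n. *)
Definition hamming_weight (n : nat) : nat := (\sum_(i < n) bit n i)%N.

(* The number l_(i+1) attached to a sequence of binary digits b_0, b_1, ...
   (most significant first): the number of indices j < i with b_j <> b_i.
   The subtraction never truncates, because the sum is at most i. *)
Definition ell (b : nat -> bool) (i : nat) : nat :=
  (let s := \sum_(j < i) b j in if b i then i - s else s)%N.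

(* The digit of weight 2 ^ -(i + 1) in the binary expansion of x in [0, 1[;
   for x = 1 all these digits are 0. A dyadic rational gets its terminating
   expansion. *)
Definition bindigit (R : realType) (x : R) (i : nat) : bool :=
  odd (Num.truncn (2 ^+ i.+1 * x)).

(* The Takagi function; only its values on [0, 1] are meaningful. The index
   is shifted, the i-th term being l_(i+1) / 2 ^ (i + 1). The series
   converges, since l_(i+1) <= i. *)
Definition takagi (R : realType) (x : R) : R :=
  limn (series (fun i : nat => (ell (bindigit x) i)%:R / 2 ^+ i.+1 : R)).

(* The digits N_k, N_(k-1), ..., N_0, N_(-1) = 0, N_(-2) = 0, ... *)
Definition natdigit (k N i : nat) : bool := (i <= k)%N && bit N (k - i)%N.

Lemma bindigit_dyadic (R : realType) (k N : nat) :
  bindigit (N%:R / 2 ^+ k.+1 : R) =1 natdigit k N.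
Proof.
move=> i; rewrite /bindigit /natdigit /bit.
have p2 m : (2 ^+ m : R) != 0 by rewrite expf_neq0 // pnatr_eq0.
have p2_gt0 m : 0 < 2 ^+ m :> R by rewrite exprn_gt0 // ltr0n.
case: leqP => [le_ik|lt_ki] /=; last first.
  have -> : 2 ^+ i.+1 * (N%:R / 2 ^+ k.+1) = (2 ^ (i - k) * N)%N%:R :> R.
    rewrite natrM natrX mulrCA mulrC; congr (_ * _).
    have -> : i.+1 = (i - k + k.+1)%N by rewrite addnS subnK // ltnW.
    by rewrite exprD mulfK.
  rewrite natrK oddM oddX /= orbF subn_eq0.
  by rewrite leqNgt lt_ki.
have -> : 2 ^+ i.+1 * (N%:R / 2 ^+ k.+1) = N%:R / 2 ^+ (k - i) :> R.
  have -> : k.+1 = (k - i + i.+1)%N by rewrite addnS subnK.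
  by rewrite exprD invfM mulrCA; congr (_ * _); rewrite mulrCA mulfV // mulr1.
congr (odd _); apply/truncn_def.
rewrite ler_pdivlMr // ltr_pdivrMr // -natrX -!natrM ler_nat ltr_nat.
by rewrite leq_trunc_div ltn_ceil // expn_gt0.
Qed.

Lemma takagi_dyadic (R : realType) (k N : nat) :
  takagi (N%:R / 2 ^+ k.+1 : R) =
  limn (series (fun i : nat => (ell (natdigit k N) i)%:R / 2 ^+ i.+1 : R)).
Proof. by rewrite /takagi (funext (bindigit_dyadic R k N)). Qed.

Lemma takagi1 (R : realType) : takagi (1 : R) = 0.
Proof.
rewrite /takagi.
have b0 i : bindigit (1 : R) i = false.
  by rewrite /bindigit mulr1 -natrX natrK oddX.
suff -> : series (fun i : nat => (ell (bindigit (1 : R)) i)%:R / 2 ^+ i.+1)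
  = fun=> (0 : R) by rewrite lim_cst.
apply/funext => n; rewrite /series /= big1 // => i _.
rewrite /ell b0 big1 ?mul0r // => j _.
by rewrite b0.
Qed.

(* Main.v *)
Require Import Defs.
From mathcomp Require Import all_boot all_order all_algebra.
From mathcomp Require Import all_classical all_reals all_analysis.
From mathcomp Require Import zify ring lra.
Import Order.TTheory GRing.Theory Num.Theory.
Import numFieldNormedType.Exports.
Local Open Scope ring_scope.

(** The Takagi function is self-similar: putting a binary digit [c] in front of
    the expansion of [x] gives
      [takagi ((c + x) / 2) = (takagi x + `|c - x|) / 2]    for [0 <= x <= 1].
    Indeed the new digit raises each [ell] by one exactly when the digit
    concerned differs from [c] ([ell_cons]), and marking by 1 the digits of [x]
    that differ from [c] gives a binary expansion of [`|c - x|]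
    ([bindigit_partial_sum_cvg]).  Half of the sum of these two contributions is
    the right-hand side ([takagi_cons]).

    The increments of [takagi] over the dyadic intervals of level [k] follow by
    induction on [k] ([takagi_dyadic_step]): when an interval of level [k] is
    shrunk into the half of [0, 1] selected by [c], the term [`|c - x|] is affine
    of slope 1 for [c = 0] and of slope -1 for [c = 1].  Hence the integer
    [2 ^ k * (takagi ((r + 1) / 2 ^ k) - takagi (r / 2 ^ k))] goes up by 1 when
    the new leading digit of [r] is 0 and down by 1 when it is 1.  Starting from
    0 at level 0, it is the number of 0s minus the number of 1s among the [k]
    digits of [r], that is [k - 2 * s1(r)]; and [s1(2 ^ k + r) = s1(r) + 1]. *)

(** * Hamming weight *)

Lemma bit_ge_size (n i : nat) : (n < 2 ^ i)%N -> bit n i = false.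
Proof. by move=> lt_n; rewrite /bit divn_small. Qed.

Lemma hamming_weight_widen (n m : nat) :
  (n < 2 ^ m)%N -> hamming_weight n = (\sum_(i < m) bit n i)%N.
Proof.
have widen p q : (p <= q)%N -> (n < 2 ^ p)%N ->
    (\sum_(i < q) bit n i = \sum_(i < p) bit n i)%N.
  move=> le_pq lt_n.
  rewrite -!(big_mkord xpredT (fun i => nat_of_bool (bit n i))).
  rewrite (@big_cat_nat _ _ _ p) //=; rewrite -[RHS]addn0; congr (_ + _)%N.
  rewrite big_nat_cond big1 // => i; rewrite andbT => /andP[le_pi _].
  by rewrite bit_ge_size // (leq_trans lt_n) // leq_exp2l.
move=> lt_n; rewrite /hamming_weight.
have [le_mn|/ltnW le_nm] := leqP m n; first exact: widen.
by rewrite (widen n m) // ltn_expl.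
Qed.

(** Adding [2 ^ k] puts a 1 just above the [k] lowest bits and leaves these
    unchanged, because [2 ^ (k - i)] is even for [i < k]. *)
Lemma hamming_weight_addX (k r : nat) :
  (r < 2 ^ k)%N -> hamming_weight (2 ^ k + r) = (hamming_weight r).+1.
Proof.
move=> lt_r; rewrite (@hamming_weight_widen _ k.+1); last first.
  by rewrite expnS mul2n -addnn ltn_add2l.
rewrite big_ord_recr /= (hamming_weight_widen r k) // -[RHS]addn1.
congr (_ + _)%N.
  apply: eq_bigr => i _; rewrite /bit divnDl ?dvdn_exp2l ?[(i <= k)%N]ltnW //.
  rewrite -expnB ?[(i <= k)%N]ltnW // oddD oddX.
  by rewrite subn_eq0 leqNgt ltn_ord.
by rewrite /bit divnDl // divnn expn_gt0 divn_small.
Qed.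

(** * Prepending a digit *)

Lemma leq_sum_bits (b : nat -> bool) (i : nat) : (\sum_(j < i) b j <= i)%N.
Proof.
rewrite -[leqRHS](card_ord i) -sum1_card.
by apply: leq_sum => j _; case: (b j).
Qed.

Lemma leq_ell (b : nat -> bool) (i : nat) : (ell b i <= i)%N.
Proof. by rewrite /ell; case: (b i); rewrite ?leq_subr ?leq_sum_bits. Qed.

(** As [ell] counts the earlier digits that differ from the current one, a new
    first digit contributes 1 or 0 and does not affect the rest of the count. *)
Lemma ell_cons (b b' : nat -> bool) (i : nat) :
  (forall j, b' j.+1 = b j) -> ell b' i.+1 = (ell b i + (b' 0 (+) b i))%N.
Proof.
move=> b'S; have le_s := leq_sum_bits b i.
rewrite /ell big_ord_recl b'S.
rewrite (eq_bigr (fun j : 'I_i => nat_of_bool (b j))); last first.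
  by move=> j _; rewrite -b'S.
by move: le_s; case: (b i); case: (b' 0) => /=; lia.
Qed.

(** * Convergence of the two series *)

Section Takagi.
Context {R : realType}.
Local Open Scope classical_set_scope.
Local Open Scope ring_scope.

Definition takagi_series (b : nat -> bool) : R^nat :=
  series (fun i : nat => (ell b i)%:R / 2 ^+ i.+1 : R).

Lemma is_cvg_takagi_series (b : nat -> bool) : cvgn (takagi_series b).
Proof.
have p2 m : 0 < 2 ^+ m :> R by rewrite exprn_gt0 // ltr0n.
apply: nondecreasing_is_cvgn.
  apply/nondecreasing_seqP => n.
  by rewrite /takagi_series seriesSr lerDl divr_ge0 // ltW.
exists 1 => _ [n _ <-].
(* From ell b i <= i: this is the n-th partial sum of the series i / 2 ^ (i + 1). *)
suff: takagi_series b n <= 1 - n.+1%:R / 2 ^+ n.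
  by move/le_trans; apply; rewrite gerBl divr_ge0 // ltW.
elim: n => [|n IHn]; first by
  rewrite /takagi_series /series/= big_geq // expr0 divr1 subrr.
rewrite /takagi_series seriesSr.
have le_ell : (ell b n)%:R / 2 ^+ n.+1 <= n%:R / 2 ^+ n.+1 :> R.
  by rewrite ler_pM2r ?invr_gt0 // ler_nat leq_ell.
apply: le_trans (lerD IHn le_ell) _.
rewrite le_eqVlt; apply/orP; left; apply/eqP; rewrite exprS -!natr1.
by field; rewrite gt_eqF.
Qed.

(** The digit extracted from [2 * y] is what doubling [Num.truncn y] misses;
    this makes the digit sums telescope in [bindigit_partial_sum]. *)
Lemma truncn_double (y : R) : 0 <= y ->
  Num.truncn (2 * y) = ((Num.truncn y).*2 + odd (Num.truncn (2 * y)))%N.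
Proof.
move=> y_ge0; have y2_ge0 : 0 <= 2 * y by rewrite mulr_ge0.
suff half_t : Num.truncn y = (Num.truncn (2 * y))./2.
  by rewrite {1}half_t addnC odd_double_half.
have /andP[t_le lt_t] := truncn_itv y2_ge0.
apply: truncn_def.
move: t_le lt_t; rewrite -{1 2}(odd_double_half (Num.truncn (2 * y))).
rewrite -muln2 -!natr1 natrD natrM.
by case: (odd _) => /= ? ?; apply/andP; split; lra.
Qed.

(** For [c = true] each digit is replaced by its complement, so the partial sum
    is the one of the constant digits 1, namely [1 - 2^-1 ^+ n], minus the one
    of the digits of [x]. *)
Lemma bindigit_partial_sum (x : R) (c : bool) (n : nat) : 0 <= x < 1 ->
  series (fun i : nat => (c (+) bindigit x i)%:R / 2 ^+ i.+1 : R) n =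
  let a := (Num.truncn (2 ^+ n * x))%:R / 2 ^+ n in
  if c then 1 - a - 2^-1 ^+ n else a.
Proof.
case/andP=> x_ge0 x_lt1; elim: n => [|n IHn].
  rewrite /series /= big_geq // expr0 mul1r.
  rewrite (@truncn_def _ x 0) ?x_ge0 // expr0 mul0r.
  by case: c; rewrite ?subr0 ?subrr.
have y_ge0 : 0 <= 2 ^+ n * x by rewrite mulr_ge0 // exprn_ge0.
rewrite seriesSr {}IHn /= /bindigit exprS -mulrA.
rewrite {2 3}truncn_double // -muln2 natrD natrM [2^-1 ^+ n.+1]exprS exprVn.
have p2 : (2 ^+ n : R) != 0 by rewrite expf_neq0 // pnatr_eq0.
by case: c; case: (odd _) => /=; field.
Qed.

Lemma bindigit_partial_sum_cvg (x : R) (c : bool) : 0 <= x < 1 ->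
  series (fun i : nat => (c (+) bindigit x i)%:R / 2 ^+ i.+1 : R) @ \oo
    --> `|c%:R - x|.
Proof.
move=> x01; case/andP: (x01) => x_ge0 x_lt1.
have half_cvg : (fun n => 2^-1 ^+ n : R) @ \oo --> (0 : R).
  by apply: cvg_expr; rewrite ger0_norm ?invr_ge0 // invf_lt1 ?ltr1n.
pose a n : R := (Num.truncn (2 ^+ n * x))%:R / 2 ^+ n.
have a_cvg : a @ \oo --> x.
  (* Truncating x after n digits loses less than 2 ^ -n. *)
  apply: (@squeeze_cvgr _ _ _ _ (fun n => x - 2^-1 ^+ n) (fun=> x)).
  - apply: nearW => n.
    have p2 : 0 < 2 ^+ n :> R by rewrite exprn_gt0.
    have /truncn_itv/andP[le_t lt_t] : 0 <= 2 ^+ n * x.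
      by rewrite mulr_ge0 // ltW.
    rewrite /a exprVn ler_pdivrMr // ler_pdivlMr // mulrBl mulVf ?gt_eqF //.
    by rewrite mulrC le_t andbT lerBlDr natr1 ltW.
  - by rewrite -[X in _ --> X]subr0; apply: cvgB => //; exact: cvg_cst.
  - exact: cvg_cst.
rewrite (_ : series _ = fun n => if c then 1 - a n - 2^-1 ^+ n else a n); last first.
  by apply/funext => n; rewrite bindigit_partial_sum.
case: c => /=.
  rewrite ger0_norm ?subr_ge0 ?ltW // -[1 - x]subr0.
  by apply: cvgB => //; apply: cvgB => //; exact: cvg_cst.
by rewrite distrC subr0 ger0_norm.
Qed.

(** * Self-similarity of the Takagi function *)

Lemma bindigit_cons0 (x : R) (c : bool) : 0 <= x < 1 ->
  bindigit ((c%:R + x) / 2) 0 = c.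
Proof.
case/andP=> x_ge0 x_lt1; rewrite /bindigit expr1 mulrC divfK ?pnatr_eq0 //.
rewrite (@truncn_def _ _ c); first by case: c.
by rewrite -natr1 lerDl x_ge0 ltrD2l.
Qed.

Lemma bindigit_consS (x : R) (c : bool) (i : nat) : 0 <= x ->
  bindigit ((c%:R + x) / 2) i.+1 = bindigit x i.
Proof.
move=> x_ge0; rewrite /bindigit.
have -> : 2 ^+ i.+2 * ((c%:R + x) / 2) = (2 ^ i.+1 * c)%:R + 2 ^+ i.+1 * x :> R.
  by rewrite natrM natrX [2 ^+ i.+2]exprS; field.
rewrite truncnD ?natr_nat ?nnegrE ?mulr_ge0 ?exprn_ge0 //.
by rewrite natrK oddD oddM oddX.
Qed.

(** The [n.+1]-st partial sum for [(c + x) / 2] has a zero first term; by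
    [ell_cons] the others split into half the [n]-th partial sum of [takagi x]
    and half the partial sum of [bindigit_partial_sum_cvg]. *)
Lemma takagi_cons_lt1 (x : R) (c : bool) : 0 <= x < 1 ->
  takagi ((c%:R + x) / 2) = (takagi x + `|c%:R - x|) / 2.
Proof.
move=> x01; have [x_ge0 _] := andP x01.
apply: cvg_lim => //; rewrite -cvg_shiftS.
rewrite (_ : [sequence _]_n = fun n => (takagi_series (bindigit x) n +
    series (fun i : nat => (c (+) bindigit x i)%:R / 2 ^+ i.+1 : R) n) / 2).
  apply: cvgMr_tmp; apply: cvgD; last exact: bindigit_partial_sum_cvg.
  exact: is_cvg_takagi_series.
apply/funext => n; rewrite /takagi_series /series /= big_nat_recl //.
have -> : ell (bindigit ((c%:R + x) / 2)) 0 = 0%N.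
  by apply/eqP; rewrite -leqn0 leq_ell.
rewrite mul0r add0r -big_split /= big_distrl /=; apply: eq_bigr => i _.
rewrite (@ell_cons (bindigit x)) => [|j]; last exact: bindigit_consS.
rewrite bindigit_cons0 // natrD [2 ^+ i.+2]exprS.
by field; rewrite expf_neq0 // pnatr_eq0.
Qed.

(** With [c = 0] and [x = 0] the functional equation reads
    [takagi 0 = takagi 0 / 2]. *)
Lemma takagi0 : takagi (0 : R) = 0.
Proof.
have := @takagi_cons_lt1 0 false; rewrite lexx ltr01 => /(_ isT).
by rewrite addr0 subrr normr0 mul0r addr0 => /eqP; lra.
Qed.

(** At [x = 1] the digits of [(c + x) / 2] are no longer [c] followed by those of
    [x], but the equation persists: for [c = 1] it is [takagi 1 = 0], and for
    [c = 0] it evaluates [takagi] at 1/2, which is also [(1 + 0) / 2].  This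
    endpoint is what the right ends [r + 1 = 2 ^ k] need. *)
Lemma takagi_cons (x : R) (c : bool) : 0 <= x <= 1 ->
  takagi ((c%:R + x) / 2) = (takagi x + `|c%:R - x|) / 2.
Proof.
case/andP=> x_ge0; rewrite le_eqVlt => /orP[/eqP ->|x_lt1]; last first.
  by apply: takagi_cons_lt1; rewrite x_ge0.
rewrite takagi1 add0r; case: c => /=.
  by rewrite subrr normr0 mul0r divff ?pnatr_eq0 // takagi1.
have := @takagi_cons_lt1 0 true; rewrite lexx ltr01 => /(_ isT) /=.
by rewrite takagi0 addr0 add0r subr0 add0r sub0r normrN.
Qed.

(** * Dyadic increments *)

Lemma dyadic_itv01 (k m : nat) :
  (m <= 2 ^ k)%N -> 0 <= (m%:R / 2 ^+ k : R) <= 1.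
Proof.
move=> le_m; have p2 : 0 < 2 ^+ k :> R by rewrite exprn_gt0.
by rewrite divr_ge0 ?(ltW p2) //= ler_pdivrMr // mul1r -natrX ler_nat.
Qed.

Lemma takagi_dyadic_cons (k r : nat) (c : bool) : (r <= 2 ^ k)%N ->
  takagi ((c * 2 ^ k + r)%:R / 2 ^+ k.+1 : R) =
  (takagi (r%:R / 2 ^+ k : R) + `|c%:R - r%:R / 2 ^+ k|) / 2.
Proof.
move=> le_r; have p2 : 0 < 2 ^+ k :> R by rewrite exprn_gt0.
rewrite -takagi_cons ?dyadic_itv01 //.
congr takagi; rewrite natrD natrM natrX exprS.
by field; rewrite gt_eqF.
Qed.

(** The increment is expressed with the weight of [r] rather than of
    [2 ^ k + r], so that the induction can strip the leading digit of [r]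
    whether it is 0 or 1. *)
Lemma takagi_dyadic_step (k r : nat) : (r < 2 ^ k)%N ->
  takagi (r.+1%:R / 2 ^+ k : R) = takagi (r%:R / 2 ^+ k : R)
    + (k%:R - 2 * (hamming_weight r)%:R) / 2 ^+ k.
Proof.
elim: k r => [|k IHk] r.
  case: r => // _; rewrite expr0 mul0r divr1 takagi0 takagi1.
  by rewrite /hamming_weight big_ord0 mulr0 subrr mul0r addr0.
have p2 : 0 < 2 ^+ k :> R by rewrite exprn_gt0.
rewrite expnS mul2n -addnn => lt_r.
have [lt_rk|le_kr] := ltnP r (2 ^ k).
  have := @takagi_dyadic_cons k r false (ltnW lt_rk).
  have := @takagi_dyadic_cons k r.+1 false lt_rk.
  have /andP[u0 _] := @dyadic_itv01 _ _ (ltnW lt_rk).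
  have /andP[v0 _] := @dyadic_itv01 _ _ lt_rk.
  rewrite !mul0n !add0n !sub0r !normrN !ger0_norm // => -> ->.
  rewrite IHk // exprS -!natr1.
  by field; rewrite gt_eqF.
rewrite -(subnKC le_kr); have : (r - 2 ^ k < 2 ^ k)%N by rewrite ltn_subLR.
move: (r - 2 ^ k)%N => {le_kr lt_r}r lt_rk.
have := @takagi_dyadic_cons k r true (ltnW lt_rk).
have := @takagi_dyadic_cons k r.+1 true lt_rk.
have /andP[_ u1] := @dyadic_itv01 _ _ (ltnW lt_rk).
have /andP[_ v1] := @dyadic_itv01 _ _ lt_rk.
rewrite !mul1n !addnS !ger0_norm ?subr_ge0 // => -> ->.
rewrite IHk // hamming_weight_addX // exprS -!natr1.
by field; rewrite gt_eqF.
Qed.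

End Takagi.

Theorem theorem26 (R : realType) (n k r : nat)
    (hr : (r < 2 ^ k)%N) (hn : n = (2 ^ k + r)%N) :
  takagi ((r + 1)%:R / 2 ^+ k : R) =
  takagi (r%:R / 2 ^+ k : R)
  + 1 / 2 ^+ k * (k%:R - 2 * (hamming_weight n)%:R + 2).
Proof.
rewrite hn hamming_weight_addX // addn1 takagi_dyadic_step //.
congr (_ + _); rewrite -[(hamming_weight r).+1%:R]natr1.
by field; rewrite expf_neq0 // pnatr_eq0.
Qed.
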